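(* For every state $\rho$ on $\mathbb{C}^d$, $C_d(\rho)=0$ implies $C_c(\rho)=0$. Equivalently, every state $\rho$ that is not diagonal in the incoherent basis (i.e. has a non-zero off-diagonal entry) satisfies $C_d(\rho)>0$.
   Context: Fix an orthonormal (incoherent) basis $\{\ket{i}\}_{i=1}^d$ of $\mathbb{C}^d$; on tensor products the incoherent basis is the product basis. An incoherent operation is a CPTP map $T(\rho)=\sum_\ell K_\ell\rho K_\ell^\dagger$ having a Kraus representation with each $K_\ell=\sum_i c_\ell(i)\ket{j_\ell(i)}\!\bra{i}$ for some function $j_\ell$ of basis indices. $\Phi_2=\ket{\Phi_2}\!\bra{\Phi_2}$, $\ket{\Phi_2}=\frac1{\sqrt2}(\ket0+\ket1)$; $F(\rho,\sigma)=\operatorname{tr}\sqrt{\rho^{1/2}\sigma\rho^{1/2}}$. Distillable coherence $C_d(\rho)$: supremum of $R\ge0$ such that there are incoherent operations $T_n$ with $F(T_n(\rho^{\otimes n}),\Phi_2^{\otimes\lfloor nR\rfloor})\to1$ as $n\to\infty$. Coherence cost $C_c(\rho)$: infimum of $R\ge0$ such that there are incoherent operations $T_n$ with $F(T_n(\Phi_2^{\otimes\lceil nR\rceil}),\rho^{\otimes n})\to1$ as $n\to\infty$. *)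

(* Defs.v *)
From HB Require Import structures.
From mathcomp Require Import all_boot all_order all_algebra.
From mathcomp Require Import complex mxtens.
From mathcomp Require Import boolp classical_sets reals constructive_ereal ereal.

Set Implicit Arguments.
Unset Strict Implicit.
Unset Printing Implicit Defensive.

Import Order.TTheory GRing.Theory Num.Theory.
Local Open Scope ring_scope.
Local Open Scope classical_set_scope.

Section Coherence.

Variable R : realType.
Local Notation C := (R[i]).

Definition mxadj {m n} (A : 'M[C]_(m, n)) : 'M[C]_(n, m) :=
  \matrix_(i, j) (A j i)^*.

Definition psdmx {n} (A : 'M[C]_n) : Prop :=
  A = mxadj A /\ forall v : 'rV[C]_n, 0 <= (v *m A *m mxadj v) 0 0.

Definition density {n} (rho : 'M[C]_n) : Prop := psdmx rho /\ \tr rho = 1.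

(* the positive semidefinite square root (unique for psd A) *)
Definition msqrt {n} (A : 'M[C]_n) : 'M[C]_n :=
  xget 0 [set S | psdmx S /\ S *m S = A].

Definition fidelity {n} (rho sigma : 'M[C]_n) : C :=
  \tr (msqrt (msqrt rho *m sigma *m msqrt rho)).

(* incoherent Kraus operator: K = sum_i c(i) |j(i)><i|, i.e. every column of K
   has at most one nonzero entry *)
Definition incoherent_kraus {m n} (K : 'M[C]_(n, m)) : Prop :=
  forall i : 'I_m, exists j : 'I_n, forall j' : 'I_n, j' != j -> K j' i = 0.

Definition incoherent_op {m n} (T : 'M[C]_m -> 'M[C]_n) : Prop :=
  exists Ks : seq 'M[C]_(n, m),
    [/\ forall K, K \in Ks -> incoherent_kraus K,
        \sum_(K <- Ks) mxadj K *m K = 1%:M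
      & forall X, T X = \sum_(K <- Ks) K *m X *m mxadj K].

(* the maximally coherent qubit Phi_2 = |Phi_2><Phi_2| *)
Definition Phi2 : 'M[C]_2 := const_mx (2%:R)^-1.

Definition tends_to_one (f : nat -> C) : Prop :=
  forall e : R, 0 < e -> exists N : nat, forall n : nat, (N <= n)%N ->
    `|f n - 1| < real_complex R e.

Definition floorn (x : R) : nat := `|Num.floor x|%N.
Definition ceiln (x : R) : nat := `|Num.ceil x|%N.

Definition distill_achievable {d} (rho : 'M[C]_d) (r : R) : Prop :=
  exists T : forall n : nat, 'M[C]_(d ^ n) -> 'M[C]_(2 ^ floorn (n%:R * r)),
    (forall n, incoherent_op (T n)) /\
    tends_to_one (fun n => fidelity (T n (ntensmx rho n))
                                   (ntensmx Phi2 (floorn (n%:R * r)))).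

Definition cost_achievable {d} (rho : 'M[C]_d) (r : R) : Prop :=
  exists T : forall n : nat, 'M[C]_(2 ^ ceiln (n%:R * r)) -> 'M[C]_(d ^ n),
    (forall n, incoherent_op (T n)) /\
    tends_to_one (fun n => fidelity (T n (ntensmx Phi2 (ceiln (n%:R * r))))
                                   (ntensmx rho n)).

Definition distillable_coherence {d} (rho : 'M[C]_d) : \bar R :=
  ereal_sup [set r%:E | r in [set r : R | 0 <= r /\ distill_achievable rho r]].

Definition coherence_cost {d} (rho : 'M[C]_d) : \bar R :=
  ereal_inf [set r%:E | r in [set r : R | 0 <= r /\ cost_achievable rho r]].

End Coherence.

(* Main.v *)
(* If rho is diagonal it can be prepared from nothing, so rate 0 is achievable
   for the cost.  Otherwise rho_ab != 0 for some a != b, and an incoherent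
   operation turns each copy of rho into the qubit state
   q_0 |+><+| + q_1 |-><-| with q_0 - q_1 = 2|rho_ab| > 0.  In the conjugate
   basis, n such copies are a classical i.i.d. string z in F_2^n.  For an
   m x n generator matrix G, the cosets of z modulo the row space of G can be
   measured incoherently, leaving m qubits whose phases are corrected once z has
   been guessed from its coset; a correct guess yields Phi_2^m exactly.  By
   averaging the Bhattacharyya bound over G, some G makes the probability of a
   wrong guess at most 2^m ((1 + 2 sqrt (q_0 q_1)) / 2)^n, and since
   q_0 != q_1 this vanishes for m = floor (n / k) with k large enough. *)
Require Import Defs.
From HB Require Import structures.
From mathcomp Require Import all_boot all_order all_algebra.
From mathcomp Require Import complex mxtens.
From mathcomp Require Import boolp classical_sets reals constructive_ereal ereal.
From mathcomp Require Import spectral ring lra.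

Set Implicit Arguments.
Unset Strict Implicit.
Unset Printing Implicit Defensive.

Import Order.TTheory GRing.Theory Num.Theory.
Local Open Scope ring_scope.

(** * Positive semidefinite matrices and fidelity *)

Section PositiveSemidefinite.

Variable R : realType.
Local Notation C := (R[i]).

Lemma mxadj_mul m n p (A : 'M[C]_(m, n)) (B : 'M[C]_(n, p)) :
  mxadj (A *m B) = mxadj B *m mxadj A.
Proof.
apply/matrixP => i j; rewrite !mxE rmorph_sum; apply: eq_bigr => k _.
by rewrite !mxE rmorphM mulrC.
Qed.

Lemma mxadjK m n (A : 'M[C]_(m, n)) : mxadj (mxadj A) = A.
Proof. by apply/matrixP => i j; rewrite !mxE conjCK. Qed.

Lemma mxadjB m n (A B : 'M[C]_(m, n)) : mxadj (A - B) = mxadj A - mxadj B.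
Proof. by apply/matrixP => i j; rewrite !mxE rmorphB. Qed.

Lemma mxadjE m n (A : 'M[C]_(m, n)) : mxadj A = map_mx Num.conj A^T.
Proof. by apply/matrixP => i j; rewrite !mxE. Qed.

Lemma mul_mxadj_diag m n (A : 'M[C]_(m, n)) i :
  (A *m mxadj A) i i = \sum_j `|A i j| ^+ 2.
Proof. by rewrite !mxE; apply: eq_bigr => j _; rewrite !mxE normCK. Qed.

Lemma mul_mxadj_eq0 m n (A : 'M[C]_(m, n)) :
  \tr (A *m mxadj A) = 0 -> A = 0.
Proof.
rewrite /mxtrace; under eq_bigr => i _ do rewrite mul_mxadj_diag.
move=> /eqP; rewrite psumr_eq0; last first.
  by move=> i _; apply: sumr_ge0 => j _; exact: exprn_ge0.
move=> /allP A0; apply/matrixP => i j; rewrite mxE.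
have := A0 i (mem_index_enum _); rewrite /= psumr_eq0; last first.
  by move=> k _; exact: exprn_ge0.
by move=> /allP /(_ j (mem_index_enum _)) /=; rewrite sqrf_eq0 normr_eq0 => /eqP.
Qed.

Lemma psdmx_gram m n (B : 'M[C]_(m, n)) : psdmx (B *m mxadj B).
Proof.
split; first by rewrite mxadj_mul mxadjK.
move=> v; rewrite mulmxA -mulmxA -mxadj_mul mul_mxadj_diag.
by apply: sumr_ge0 => j _; exact: exprn_ge0.
Qed.

(** Diagonalise [A] by a unitary and take square roots of the eigenvalues. *)
Lemma psdmx_sqrt n (A : 'M[C]_n) :
  psdmx A -> exists2 S : 'M[C]_n, psdmx S & S *m S = A.
Proof.
move=> [Aadj Apos].
have Anormal : A \is normalmx.
  by apply/normalmxP; rewrite -mxadjE -Aadj.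
have := orthomx_spectralP Anormal.
set P := spectralmx A; set d := spectral_diag A.
have Pu : P \is unitarymx := spectral_unitarymx A.
rewrite invmx_unitary // -mxadjE => AE.
have PP : P *m mxadj P = 1%:M by rewrite mxadjE; apply/unitarymxP.
have d_ge0 i : 0 <= d 0 i.
  have := Apos (row i P).
  have -> : (row i P *m A *m mxadj (row i P)) 0 0 = (P *m A *m mxadj P) i i.
    rewrite -row_mul !mxE; apply: eq_bigr => k _; rewrite !mxE.
    by congr (_ * _).
  by rewrite AE !mulmxA PP mul1mx -mulmxA PP mulmx1 mxE eqxx mulr1n.
(* [f] holds fourth roots of the eigenvalues, so that the candidate root is visibly a Gram matrix
   and hence psd. *)
pose e := \row_i sqrtC (d 0 i); pose f := \row_i sqrtC (e 0 i).
have e_ge0 i : 0 <= e 0 i by rewrite mxE sqrtC_ge0.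
exists (mxadj P *m diag_mx e *m P).
  have -> : mxadj P *m diag_mx e *m P =
      (mxadj P *m diag_mx f) *m mxadj (mxadj P *m diag_mx f).
    rewrite mxadj_mul mxadjK !mulmxA; congr (_ *m _); rewrite -mulmxA.
    congr (_ *m _); have -> : mxadj (diag_mx f) = diag_mx f.
      apply/matrixP => i j; rewrite !mxE eq_sym.
      case: eqVneq => [->|_]; last by rewrite !mulr0n conjC0.
      by rewrite !mulr1n geC0_conj // !sqrtC_ge0.
    rewrite mulmx_diag; congr diag_mx; apply/rowP => i.
    by rewrite [RHS]mxE mxE -[RHS]expr2 [f _ _]mxE sqrtCK mxE.
  exact: psdmx_gram.
rewrite -!mulmxA (mulmxA P) PP mul1mx (mulmxA (diag_mx e)) mulmx_diag [RHS]AE.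
rewrite -mulmxA; congr (_ *m (diag_mx _ *m _)); apply/rowP => i.
by rewrite mxE -expr2 mxE sqrtCK.
Qed.

(* With D = S - T, S^2 = T^2 gives SD + DT = 0, so that tr(DSD) + tr(DTD) = 0
   where both traces are nonnegative. *)
Lemma psdmx_sqrt_inj n (S T : 'M[C]_n) :
  psdmx S -> psdmx T -> S *m S = T *m T -> S = T.
Proof.
move=> pS pT ST.
(* Splitting [S] and [T] in turn as squares of [X] and [Y] turns both traces into squared Frobenius
   norms, whose vanishing kills DX and DY. *)
have [X pX XS] := psdmx_sqrt pS; have [Y pY YT] := psdmx_sqrt pT.
pose D := S - T.
have Dadj : mxadj D = D by rewrite mxadjB -pS.1 -pT.1.
have eq0 : S *m D + D *m T = 0.
  by rewrite /D mulmxBr mulmxBl ST addrA subrK subrr.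
have trE (Z W : 'M[C]_n) : psdmx Z -> Z *m Z = W ->
    \tr (D *m W *m D) = \tr ((D *m Z) *m mxadj (D *m Z)).
  by move=> pZ <-; rewrite mxadj_mul -pZ.1 Dadj !mulmxA.
have tr_ge0 (Z : 'M[C]_n) : 0 <= \tr (Z *m mxadj Z).
  apply: sumr_ge0 => i _; rewrite mul_mxadj_diag.
  by apply: sumr_ge0 => j _; exact: exprn_ge0.
have tr0 : \tr (D *m S *m D) + \tr (D *m T *m D) = 0.
  rewrite (mxtrace_mulC (D *m T)) -mxtraceD -!mulmxA -mulmxDr.
  by rewrite eq0 mulmx0 mxtrace0.
have DS0 : D *m S = 0.
  rewrite -XS mulmxA (_ : D *m X = 0) ?mul0mx //; apply: mul_mxadj_eq0.
  move/eqP: tr0; rewrite (trE _ _ pX XS) (trE _ _ pY YT) paddr_eq0 //.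
  by case/andP => /eqP.
have DT0 : D *m T = 0.
  rewrite -YT mulmxA (_ : D *m Y = 0) ?mul0mx //; apply: mul_mxadj_eq0.
  move/eqP: tr0; rewrite (trE _ _ pX XS) (trE _ _ pY YT) paddr_eq0 //.
  by case/andP => _ /eqP.
apply/eqP; rewrite -subr_eq0 -/D; apply/eqP/mul_mxadj_eq0.
by rewrite Dadj {2}/D mulmxBr DS0 DT0 subrr mxtrace0.
Qed.

Lemma msqrtP n (A : 'M[C]_n) :
  psdmx A -> psdmx (msqrt A) /\ msqrt A *m msqrt A = A.
Proof.
move=> /psdmx_sqrt[S pS SA]; rewrite /msqrt.
by case: xgetP => [T _ //|/(_ S)]; case.
Qed.

(** [msqrt] is picked by [xget]; by uniqueness, any psd root that can be exhibited is its value. *)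
Lemma msqrt_unique n (A S : 'M[C]_n) :
  psdmx S -> S *m S = A -> msqrt A = S.
Proof.
move=> pS <-; have pSS : psdmx (S *m S) by rewrite {2}pS.1; exact: psdmx_gram.
by have [pT TT] := msqrtP pSS; apply: psdmx_sqrt_inj.
Qed.

Lemma fidelity_refl n (rho : 'M[C]_n) : psdmx rho -> fidelity rho rho = \tr rho.
Proof.
move=> prho; rewrite /fidelity; congr mxtrace; apply: msqrt_unique => //.
by have [_ {1 2 4}<-] := msqrtP prho; rewrite !mulmxA.
Qed.

(** With S the root of [rho] and v = S phi, the matrix under the outer root is the rank-one v v^*,
    whose root is v v^* / |v|, of trace |v|. *)
Lemma fidelity_pure n (rho : 'M[C]_n) (phi : 'cV[C]_n) : psdmx rho ->
  fidelity rho (phi *m mxadj phi) = sqrtC ((mxadj phi *m rho *m phi) 0 0).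
Proof.
move=> prho; have [pS SS] := msqrtP prho; rewrite /fidelity.
set S := msqrt rho in pS SS *.
pose v := S *m phi; pose a := (mxadj v *m v) 0 0.
have -> : S *m (phi *m mxadj phi) *m S = v *m mxadj v.
  by rewrite /v mxadj_mul -pS.1 !mulmxA.
have -> : (mxadj phi *m rho *m phi) 0 0 = a.
  by rewrite /a /v mxadj_mul -pS.1 -SS !mulmxA.
have aE : mxadj v *m v = a%:M by rewrite [LHS]mx11_scalar.
have tra : \tr (v *m mxadj v) = a by rewrite mxtrace_mulC /mxtrace big_ord1.
have a_ge0 : 0 <= a.
  by rewrite /a -{2}[v]mxadjK mul_mxadj_diag; apply: sumr_ge0 => j _; exact: exprn_ge0.
(* If a = 0 then v = 0 and the root is 0; otherwise one may divide by |v|, which is the square of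
   the [b] below. *)
have [a0|a_neq0] := eqVneq a 0.
  rewrite a0 sqrtC0 (mul_mxadj_eq0 (etrans tra a0)) mul0mx.
  rewrite (@msqrt_unique _ _ 0) ?mxtrace0 ?mulmx0 //.
  by have := psdmx_gram (0 : 'M[C]_n); rewrite mul0mx.
pose b := sqrtC (sqrtC a).
have b_ge0 : 0 <= b by rewrite !sqrtC_ge0.
have bb : b * b = sqrtC a by rewrite -expr2 sqrtCK.
have adjZ (c : C) : mxadj (c *: v) = c^* *: mxadj v.
  by apply/matrixP => i j; rewrite !mxE rmorphM.
rewrite (@msqrt_unique _ _ ((sqrtC a)^-1 *: (v *m mxadj v))).
- rewrite mxtraceZ tra -{2}(sqrtCK a) expr2 mulKf //.
  by rewrite sqrtC_eq0.
- have -> : (sqrtC a)^-1 *: (v *m mxadj v) = (b^-1 *: v) *m mxadj (b^-1 *: v).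
    rewrite adjZ geC0_conj ?invr_ge0 // -scalemxAl -scalemxAr scalerA.
    by rewrite -invfM bb.
  exact: psdmx_gram.
- rewrite -scalemxAl -scalemxAr scalerA mulmxA -(mulmxA v) aE.
  rewrite mul_mx_scalar -scalemxAl scalerA -invfM -expr2 sqrtCK mulVf //.
  by rewrite scale1r.
Qed.

End PositiveSemidefinite.

(** * Tensor powers and incoherent operations *)

Lemma tensmx_suml (R : pzRingType) (I : Type) (r : seq I) m n p q
    (F : I -> 'M[R]_(m, n)) (B : 'M[R]_(p, q)) :
  (\sum_(i <- r) F i) *t B = \sum_(i <- r) (F i *t B).
Proof.
apply/matrixP => i j; rewrite mxE !summxE mulr_suml.
by apply: eq_bigr => k _; rewrite mxE.
Qed.

Lemma tensmx_sumr (R : pzRingType) (I : Type) (r : seq I) m n p q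
    (A : 'M[R]_(m, n)) (F : I -> 'M[R]_(p, q)) :
  A *t (\sum_(i <- r) F i) = \sum_(i <- r) (A *t F i).
Proof.
apply/matrixP => i j; rewrite mxE !summxE mulr_sumr.
by apply: eq_bigr => k _; rewrite mxE.
Qed.

Lemma tensmx1 (R : pzRingType) m n : 1%:M *t 1%:M = 1%:M :> 'M[R]_(m * n).
Proof.
apply/matrixP => i j; case: (mxtens_indexP i) => i1 i2.
case: (mxtens_indexP j) => j1 j2; rewrite tensmxE !mxE.
rewrite (can_eq (@mxtens_indexK m n)) xpair_eqE.
by case: (i1 == j1); case: (i2 == j2); rewrite ?mulr0 ?mulr1 ?mul0r.
Qed.

(** Reading an index as a word of n letters turns entries of a tensor power into products over
    positions. The bijection is chosen before [A], so one reading serves every matrix. *)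
Lemma ntensmx_bij d n : exists2 g : 'I_(d ^ n) -> 'rV['I_d]_n, bijective g &
  forall (R : pzRingType) (A : 'M[R]_d) i j,
    ntensmx A n i j = \prod_k A (g i 0 k) (g j 0 k).
Proof.
elim: n => [|[|n] [g [h gK hK] gE]].
- have r0 : 'rV['I_d]_0 by apply: matrix_of_fun => // _ [].
  exists (fun=> r0).
    exists (fun=> 0) => [i|v]; first by rewrite ord1.
    by apply/rowP; case.
  by move=> R A i j; rewrite big_ord0 !ord1 ntensmx0 mxE.
(* The tensor power recursion starts at exponent 1, which is therefore a separate base case. *)
- exists (fun i : 'I_d => const_mx i : 'rV_1).
    exists (fun v : 'rV_1 => v 0 0) => [i|v]; first by rewrite mxE.
    by apply/rowP => k; rewrite mxE ord1.
  by move=> R A i j; rewrite big_ord1 !mxE.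
pose unidx := @mxtens_unindex d (d ^ n.+1).
pose G (i : 'I_(d ^ n.+2)) : 'rV['I_d]_(1 + n.+1) :=
  row_mx (const_mx (unidx i).1) (g (unidx i).2).
have G0 i : G i 0 ord0 = (unidx i).1.
  by rewrite (_ : ord0 = lshift n.+1 (0 : 'I_1)) ?row_mxEl ?mxE //; apply: val_inj.
have GS i k : G i 0 (lift ord0 k) = g (unidx i).2 0 k.
  by rewrite -(rshift1 k) row_mxEr.
exists G.
  exists (fun v : 'rV_(1 + n.+1) =>
      mxtens_index (lsubmx v 0 0, h (rsubmx v))) => [i|v].
    by rewrite row_mxKl row_mxKr mxE gK -surjective_pairing mxtens_unindexK.
  rewrite /G /unidx mxtens_indexK /= hK -[RHS]hsubmxK; congr row_mx.
  by apply/rowP => k; rewrite mxE ord1.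
move=> R A i j; rewrite big_ord_recl ntensmxSS mxE gE !G0.
by congr (_ * _); apply: eq_bigr => k _; rewrite !GS.
Qed.

(** Row vectors index the sum because words over a field will also be added and multiplied by
    matrices. *)
Lemma bigA_distr_rV (R : comPzRingType) (I : finType) n
    (F : 'I_n -> I -> R) :
  \sum_(v : 'rV[I]_n) \prod_k F k (v 0 k) = \prod_k \sum_a F k a.
Proof.
rewrite bigA_distr_bigA /= (reindex (fun f : {ffun 'I_n -> I} => \row_k f k)) /=.
  by apply: eq_bigr => f _; apply: eq_bigr => k _; rewrite mxE.
exists (fun v : 'rV[I]_n => [ffun k => v 0 k]) => [f _|v _].
  by apply/ffunP => k; rewrite ffunE mxE.
by apply/rowP => k; rewrite mxE ffunE.
Qed.

Lemma mxtrace_ntens (R : comPzRingType) d n (A : 'M[R]_d) :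
  \tr (ntensmx A n) = (\tr A) ^+ n.
Proof.
have [g gbij gE] := ntensmx_bij d n.
rewrite -[n in RHS]card_ord -prodr_const -(bigA_distr_rV (fun=> fun a => A a a)).
by rewrite (reindex g (onW_bij predT gbij)); apply: eq_bigr => i _; exact: gE.
Qed.

Lemma ntensmx_mul (R : comPzRingType) d n (A B : 'M[R]_d) :
  ntensmx (A *m B) n = ntensmx A n *m ntensmx B n.
Proof.
elim: n => [|[|n] IH]; first exact: (esym (mulmx1 _)).
  by [].
by rewrite !ntensmxSS tensmx_mul -IH.
Qed.

Section IncoherentOperations.

Variable R : realType.
Local Notation C := (R[i]).

Lemma mxadj_tens m n p q (A : 'M[C]_(m, n)) (B : 'M[C]_(p, q)) :
  mxadj (A *t B) = mxadj A *t mxadj B.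
Proof. by apply/matrixP => i j; rewrite !mxE rmorphM. Qed.

Lemma mxadj1 n : mxadj (1%:M : 'M[C]_n) = 1%:M.
Proof.
by apply/matrixP => i j; rewrite !mxE eq_sym rmorph_nat.
Qed.

Lemma mxadj_ntens d n (A : 'M[C]_d) : mxadj (ntensmx A n) = ntensmx (mxadj A) n.
Proof.
elim: n => [|[|n] IH] //; first exact: mxadj1.
by rewrite !ntensmxSS mxadj_tens IH.
Qed.

Lemma psdmx_ntens d n (A : 'M[C]_d) : psdmx A -> psdmx (ntensmx A n).
Proof.
move=> /psdmx_sqrt[S pS <-]; rewrite {2}pS.1 ntensmx_mul -mxadj_ntens.
exact: psdmx_gram.
Qed.

Lemma psdmx_sum n (I : Type) (r : seq I) (F : I -> 'M[C]_n) :
  (forall i, psdmx (F i)) -> psdmx (\sum_(i <- r) F i).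
Proof.
move=> pF; elim/big_rec: _ => [|i A _ [Aadj Apos]].
  by have := psdmx_gram (0 : 'M[C]_n); rewrite mul0mx.
split.
  by rewrite {1}(pF i).1 {1}Aadj; apply/matrixP => a b; rewrite !mxE rmorphD.
move=> v; rewrite mulmxDr mulmxDl mxE addr_ge0 //; exact: (pF i).2.
Qed.

Lemma psdmx_incoherent_op m n (T : 'M[C]_m -> 'M[C]_n) (A : 'M[C]_m) :
  incoherent_op T -> psdmx A -> psdmx (T A).
Proof.
move=> [Ks [_ _ TE]] /psdmx_sqrt[S pS <-]; rewrite TE; apply: psdmx_sum => K.
rewrite {2}pS.1 mulmxA -mulmxA -mxadj_mul; exact: psdmx_gram.
Qed.

Lemma incoherent_kraus_mul m n p (L : 'M[C]_(p, n)) (K : 'M[C]_(n, m)) :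
  incoherent_kraus L -> incoherent_kraus K -> incoherent_kraus (L *m K).
Proof.
move=> iL iK i; have [j Kj] := iK i; have [l Ll] := iL j.
exists l => l' l'l; rewrite mxE big1 // => k _.
by have [->|/Kj->] := eqVneq k j; rewrite ?mulr0 // Ll ?mul0r.
Qed.

Lemma incoherent_kraus_tens m n p q (K : 'M[C]_(n, m)) (L : 'M[C]_(q, p)) :
  incoherent_kraus K -> incoherent_kraus L -> incoherent_kraus (K *t L).
Proof.
move=> iK iL i; case: (mxtens_indexP i) => i1 i2.
have [j1 Kj] := iK i1; have [j2 Lj] := iL i2.
exists (mxtens_index (j1, j2)) => l; case: (mxtens_indexP l) => l1 l2.
rewrite (can_eq (@mxtens_indexK n q)) xpair_eqE negb_and tensmxE.
by case/orP => [/Kj->|/Lj->]; rewrite ?mul0r ?mulr0.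
Qed.

Lemma incoherent_op_id n : incoherent_op (id : 'M[C]_n -> 'M[C]_n).
Proof.
exists [:: 1%:M]; split=> [K|| X].
- rewrite inE => /eqP -> i; exists i => j ji.
  by rewrite mxE (negPf ji).
- by rewrite big_seq1 mulmx1 mxadj1.
- by rewrite big_seq1 mxadj1 mulmx1 mul1mx.
Qed.

Lemma incoherent_op_comp m n p (T : 'M[C]_n -> 'M[C]_p) (U : 'M[C]_m -> 'M[C]_n) :
  incoherent_op T -> incoherent_op U -> incoherent_op (T \o U).
Proof.
move=> [Ks [iK sK TE]] [Ls [iL sL UE]].
exists [seq K *m L | K <- Ks, L <- Ls]; split=> [A||X].
- by move=> /allpairsP[[K L] [/= /iK ? /iL ? ->]]; apply: incoherent_kraus_mul.
- rewrite big_allpairs_dep exchange_big /= -sL; apply: eq_bigr => L _.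
  under eq_bigr => K _ do rewrite mxadj_mul mulmxA -(mulmxA (mxadj L)).
  by rewrite -mulmx_suml -mulmx_sumr sK mulmx1.
- rewrite big_allpairs_dep /= TE UE; apply: eq_bigr => K _.
  rewrite mulmx_sumr mulmx_suml; apply: eq_bigr => L _.
  by rewrite mxadj_mul !mulmxA.
Qed.

(** The Kraus operators are the pairwise tensor products. Knowing the action on product inputs is
    enough for tensor powers. *)
Lemma incoherent_op_tens m n p q (T : 'M[C]_m -> 'M[C]_n) (U : 'M[C]_p -> 'M[C]_q) :
  incoherent_op T -> incoherent_op U ->
  exists2 V, incoherent_op V & forall X Y, V (X *t Y) = T X *t U Y.
Proof.
move=> [Ks [iK sK TE]] [Ls [iL sL UE]].
pose KLs := [seq K *t L | K <- Ks, L <- Ls].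
exists (fun X => \sum_(K <- KLs) K *m X *m mxadj K) => [|X Y].
  exists KLs; split=> // [A|].
    by move=> /allpairsP[[K L] [/= /iK ? /iL ? ->]]; apply: incoherent_kraus_tens.
  rewrite big_allpairs_dep /= -tensmx1 -sK -sL tensmx_suml; apply: eq_bigr => K _.
  rewrite tensmx_sumr; apply: eq_bigr => L _.
  by rewrite mxadj_tens tensmx_mul.
rewrite big_allpairs_dep /= TE UE tensmx_suml; apply: eq_bigr => K _.
rewrite tensmx_sumr; apply: eq_bigr => L _.
by rewrite mxadj_tens !tensmx_mul.
Qed.

Lemma incoherent_op_ntens d e n (T : 'M[C]_d -> 'M[C]_e) : incoherent_op T ->
  exists2 V : 'M[C]_(d ^ n) -> 'M[C]_(e ^ n), incoherent_op V &
    forall X, V (ntensmx X n) = ntensmx (T X) n.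
Proof.
move=> iT; elim: n => [|[|n] [V iV VE]].
- by exists id => //; exact: (incoherent_op_id 1).
- by exists T.
have [W iW WE] := incoherent_op_tens iT iV.
by exists W => // X; rewrite !ntensmxSS WE VE.
Qed.

End IncoherentOperations.

(** * Single-copy operations *)

Section Single.

Variable R : realType.
Local Notation C := (R[i]).

Lemma mxadjZ m n (c : C) (A : 'M[C]_(m, n)) : mxadj (c *: A) = c^* *: mxadj A.
Proof. by apply/matrixP => i j; rewrite !mxE rmorphM. Qed.

Lemma mxadjD m n (A B : 'M[C]_(m, n)) : mxadj (A + B) = mxadj A + mxadj B.
Proof. by apply/matrixP => i j; rewrite !mxE rmorphD. Qed.

Lemma mxadj_delta m n i j : mxadj (delta_mx i j : 'M[C]_(m, n)) = delta_mx j i.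
Proof. by apply/matrixP => k l; rewrite !mxE andbC rmorph_nat. Qed.

Lemma delta_mul_delta m n (A : 'M[C]_n) (i l : 'I_m) (j k : 'I_n) :
  delta_mx i j *m A *m delta_mx k l = A j k *: delta_mx i l :> 'M[C]_m.
Proof.
rewrite -(mul_delta_mx (0 : 'I_1)) -(mul_delta_mx (0 : 'I_1) k) !mulmxA.
rewrite -(mulmxA _ _ A) -rowE -(mulmxA _ (row j A)) -colE.
rewrite [col k _]mx11_scalar mul_mx_scalar -scalemxAl mul_delta_mx.
by rewrite !mxE.
Qed.

Lemma incoherent_kraus_delta m n (c : C) i j :
  incoherent_kraus (c *: delta_mx i j : 'M[C]_(m, n)).
Proof.
by move=> k; exists i => l /negPf li; rewrite !mxE li mulr0.
Qed.

(** The Kraus operators sqrt(sigma_jj) |j><i| discard the input and prepare [sigma]; each has at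
    most one nonzero entry, so incoherence is immediate. *)
Lemma incoherent_op_prepare m n (sigma : 'M[C]_n) :
  density sigma -> is_diag_mx sigma ->
  exists2 T : 'M[C]_m -> 'M[C]_n, incoherent_op T &
    forall X, \tr X = 1 -> T X = sigma.
Proof.
move=> [psigma tr1] /is_diag_mxP dsigma.
have s_ge0 j : 0 <= sigma j j.
  have := psigma.2 (delta_mx 0 j); rewrite mxadj_delta delta_mul_delta.
  by rewrite !mxE mulr1.
have sj j : sqrtC (sigma j j) * (sqrtC (sigma j j))^* = sigma j j.
  by rewrite geC0_conj ?sqrtC_ge0 // -expr2 sqrtCK.
pose Ks := [seq sqrtC (sigma j j) *: delta_mx j i : 'M[C]_(n, m)
             | j <- index_enum 'I_n, i <- index_enum 'I_m].
exists (fun X => \sum_(K <- Ks) K *m X *m mxadj K) => [|X trX].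
  exists Ks; split=> // [K|].
    by move=> /allpairsP[[j i] [_ _ ->]]; exact: incoherent_kraus_delta.
  rewrite big_allpairs_dep exchange_big /= (mx1_sum_delta C m).
  apply: eq_bigr => i _.
  under eq_bigr => j _ do
    rewrite mxadjZ mxadj_delta -scalemxAl -scalemxAr scalerA mul_delta_mx mulrC sj.
  by rewrite -scaler_suml -/(mxtrace _) tr1 scale1r.
rewrite big_allpairs_dep /= [RHS](matrix_sum_delta sigma); apply: eq_bigr => j _.
rewrite (bigD1 j) //= [X in _ = _ + X]big1 => [|k kj]; last first.
  by rewrite dsigma ?scale0r // eq_sym.
under eq_bigr => i _ do
  rewrite mxadjZ mxadj_delta -!scalemxAl -scalemxAr scalerA sj delta_mul_delta.
by rewrite -scaler_sumr -scaler_suml -/(mxtrace _) trX scale1r addr0.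
Qed.

(** In the conjugate basis this is (1/2 + t) |+><+| + (1/2 - t) |-><-|. *)
Definition twirled_qubit (t : C) : 'M[C]_2 :=
  \matrix_(i, j) if i == j then 2%:R^-1 else t.

(* Swap |a> and |b> with probability 1/2, after a phase making rho_ab positive;
   every other basis state is sent to a uniformly random bit. *)
Lemma incoherent_op_twirl d (rho : 'M[C]_d) a b :
  density rho -> a != b ->
  exists2 T : 'M[C]_d -> 'M[C]_2, incoherent_op T &
    T rho = twirled_qubit `|rho a b|.
Proof.
move=> [prho tr1] ab.
have conjM (x y : C) : (x * y)^* = x^* * y^* by exact: rmorphM.
(* [w] is the conjugate phase of rho_ab, or 1 if that entry vanishes. *)
have [w ww wE] : exists2 w : C, w^* * w = 1 & w * rho a b = `|rho a b|.
  have [->|r0] := eqVneq (rho a b) 0.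
    by exists 1; rewrite ?conjC1 ?mulr1 ?mulr0 ?normr0.
  have n0 : `|rho a b| != 0 by rewrite normr_eq0.
  exists ((rho a b)^* / `|rho a b|).
    rewrite conjM conjCK geC0_conj ?invr_ge0 // mulrACA.
    by rewrite -normCK -invfM -expr2 divff // expf_neq0.
  by rewrite mulrAC [_^* * _]mulrC -normCK expr2 mulfK.
have half2 : 2%:R^-1 + 2%:R^-1 = 1 :> C.
  by rewrite -mulr2n -[LHS]mulr_natl divff ?pnatr_eq0.
pose s : C := sqrtC (2%:R^-1).
have ss : s^* * s = 2%:R^-1.
  by rewrite geC0_conj ?sqrtC_ge0 ?invr_ge0 ?ler0n // -expr2 sqrtCK.
have rba : rho b a = (rho a b)^* by rewrite {1}prho.1 mxE.
pose flip (x : 'I_2) := rev_ord x.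
have xflip x : (x == flip x) = false by case: x => [[|[|]]].
have flipx x : (flip x == x) = false by rewrite eq_sym.
(* [K x] sends a and b to opposite bits, so each column has at most one nonzero entry while the
   coherence between a and b survives. [L] covers the remaining basis states. *)
pose K x : 'M[C]_(2, d) := s *: (w *: delta_mx x a + delta_mx (flip x) b).
pose L c x : 'M[C]_(2, d) := s *: delta_mx x c.
pose rest := [seq c <- index_enum 'I_d | (c != a) && (c != b)].
pose Ks := [seq K x | x <- index_enum 'I_2] ++
           [seq L c x | c <- rest, x <- index_enum 'I_2].
have split_sum (V : zmodType) (F : 'I_d -> V) :
    \sum_c F c = F a + (F b + \sum_(c <- rest) F c).
  rewrite (bigD1 a) //= (bigD1 b) 1?eq_sym //=; congr (_ + (_ + _)).
  by rewrite big_filter.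
have adjK x : mxadj (K x) = s^* *: (w^* *: delta_mx a x + delta_mx b (flip x)).
  by rewrite mxadjZ mxadjD mxadjZ !mxadj_delta.
have adjL c x : mxadj (L c x) = s^* *: delta_mx c x.
  by rewrite mxadjZ mxadj_delta.
exists (fun X => \sum_(K <- Ks) K *m X *m mxadj K).
  exists Ks; split=> // [M|].
    rewrite mem_cat => /orP[/mapP[x _ ->] i|].
      have [->|ia] := eqVneq i a.
        by exists x => j jx; rewrite !mxE (negPf jx) (negPf ab) andbF mulr0 addr0 mulr0.
      by exists (flip x) => j jx; rewrite !mxE (negPf jx) (negPf ia) andbF mulr0 addr0 mulr0.
    by move=> /allpairsP[[c x] [_ _ ->]]; exact: incoherent_kraus_delta.
  rewrite big_cat big_map big_allpairs_dep /= mx1_sum_delta split_sum addrA.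
  congr (_ + _).
    have KK x : mxadj (K x) *m K x = 2%:R^-1 *: (delta_mx a a + delta_mx b b).
      rewrite adjK /K -scalemxAl -scalemxAr scalerA ss; congr (_ *: _).
      rewrite mulmxDl !mulmxDr -!scalemxAl -!scalemxAr scalerA ww scale1r.
      rewrite !mul_delta_mx !mul_delta_mx_cond xflip flipx.
      by rewrite !mulr0n !scaler0 addr0 add0r.
    by under eq_bigr => x _ do rewrite KK;
       rewrite big_ord_recl big_ord1 -scalerDl half2 scale1r.
  apply: eq_bigr => c _.
  have LL x : mxadj (L c x) *m L c x = 2%:R^-1 *: delta_mx c c.
    by rewrite adjL /L -scalemxAl -scalemxAr scalerA ss mul_delta_mx.
  by under eq_bigr => x _ do rewrite LL;
     rewrite big_ord_recl big_ord1 -scalerDl half2 scale1r.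
have KK x : K x *m rho *m mxadj (K x) = 2%:R^-1 *:
    (rho a a *: delta_mx x x + rho b b *: delta_mx (flip x) (flip x)
     + `|rho a b| *: (delta_mx x (flip x) + delta_mx (flip x) x)).
  rewrite adjK /K -!scalemxAl -scalemxAr scalerA (mulrC s) ss; congr (_ *: _).
  rewrite !mulmxDl !mulmxDr -!scalemxAl -!scalemxAr !delta_mul_delta !scalerA.
  rewrite [w * _^*]mulrC ww mul1r wE.
  rewrite rba -conjM wE (geC0_conj (normr_ge0 _)) scalerDr.
  by rewrite [X in _ + X = _]addrC addrACA.
have LL c x : L c x *m rho *m mxadj (L c x) = 2%:R^-1 *: (rho c c *: delta_mx x x).
  rewrite adjL /L -!scalemxAl -scalemxAr scalerA (mulrC s) ss.
  by rewrite delta_mul_delta.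
rewrite big_cat big_map big_allpairs_dep /=.
under eq_bigr => x _ do rewrite KK.
under [X in _ + X]eq_bigr => c _ do under eq_bigr => x _ do rewrite LL.
have I2 : \sum_(x < 2) delta_mx x x = 1%:M :> 'M[C]_2 by rewrite -mx1_sum_delta.
have -> : \sum_(c <- rest) \sum_x 2%:R^-1 *: (rho c c *: delta_mx x x)
    = (2%:R^-1 * \sum_(c <- rest) rho c c) *: (1%:M : 'M[C]_2).
  under eq_bigr => c _ do rewrite -!scaler_sumr I2.
  by rewrite -scaler_sumr -scaler_suml scalerA.
have flipE : (flip ord0 = 1) * (flip (lift ord0 ord0) = 0).
  by split; apply: val_inj.
(* Trace one makes the remaining weight complement rho_aa + rho_bb, so both diagonal entries come
   out as 1/2. *)
have restE : \sum_(c <- rest) rho c c = 1 - rho a a - rho b b.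
  by rewrite -tr1 /mxtrace split_sum; ring.
rewrite big_ord_recl big_ord1 !flipE.
have -> : lift ord0 ord0 = 1 :> 'I_2 by apply: val_inj.
rewrite restE; apply/matrixP => i j; rewrite !mxE.
by case: i => [[|[|]]] //= ?; case: j => [[|[|]]] //= ?;
  rewrite ?mulr1n ?mulr0n; field.
Qed.

End Single.

(** * Random linear codes *)

Section Codes.

Variable R : realType.

Lemma exists_ler_average (I : finType) (x0 : I) (F : I -> R) (c : R) :
  \sum_i F i <= #|I|%:R * c -> exists i, F i <= c.
Proof.
move=> Fc; apply: contrapT => /forallNP Flt; move: Fc; apply/negP.
rewrite -ltNge mulr_natl -sumr_const; apply: ltr_sum => [|i _]; last first.
  by rewrite ltNge; apply/negP/Flt.
by apply/hasP; exists x0; rewrite ?mem_index_enum.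
Qed.

(* If u c = 1, translating G by c v translates u G by v. *)
Lemma sum_mulmx_uniform (F : finFieldType) m n (f : 'rV[F]_n -> R) (u : 'rV[F]_m) :
  u != 0 ->
  #|{: 'rV[F]_n}|%:R * \sum_(G : 'M[F]_(m, n)) f (u *m G)
  = #|{: 'M[F]_(m, n)}|%:R * \sum_v f v.
Proof.
move=> u0; have /row_freeP[c uc] : row_free u by rewrite /row_free rank_rV u0.
rewrite !mulr_natl -!sumr_const.
transitivity (\sum_(v : 'rV[F]_n) \sum_(G : 'M[F]_(m, n)) f (u *m G + v)).
  apply: eq_bigr => v _; rewrite (reindex_inj (addrI (c *m v))).
  by apply: eq_bigr => G _; rewrite mulmxDr mulmxA uc mul1mx addrC.
rewrite exchange_big; apply: eq_bigr => G _.
by rewrite [RHS](reindex_inj (addrI (u *m G))).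
Qed.

(** First-moment argument: for u != 0 the word u G is uniform when G is, so each term averages over
    G to the mean of [f]. *)
Lemma exists_code (F : finFieldType) m n (f : 'rV[F]_n -> R) :
  (forall v, 0 <= f v) ->
  exists G : 'M[F]_(m, n),
    \sum_(u | u != 0) f (u *m G) <= #|F|%:R ^+ m / #|F|%:R ^+ n * \sum_v f v.
Proof.
move=> f_ge0; apply: (exists_ler_average 0).
have cardV k : (#|{: 'rV[F]_k}|%:R : R) = #|F|%:R ^+ k by rewrite card_mx mul1n natrX.
have q_gt0 : 0 < #|F|%:R :> R by rewrite ltr0n; apply/card_gt0P; exists 0.
rewrite exchange_big /=.
have uniform (u : 'rV[F]_m) : u != 0 -> \sum_(G : 'M[F]_(m, n)) f (u *m G)
    = #|{: 'M[F]_(m, n)}|%:R * (\sum_v f v) / #|F|%:R ^+ n.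
  move=> u0; rewrite -(sum_mulmx_uniform f u0) cardV mulrAC mulfV ?mul1r //.
  by rewrite expf_neq0 // gt_eqF.
rewrite (eq_bigr _ uniform) sumr_const; set S := \sum_v _.
have S_ge0 : 0 <= S by apply: sumr_ge0.
have -> : #|F|%:R ^+ m / #|F|%:R ^+ n * S = S / #|F|%:R ^+ n * #|F|%:R ^+ m.
  by rewrite mulrC mulrCA mulrC.
rewrite mulrA -[leLHS]mulr_natr -!mulrA ler_wpM2l ?ler0n // ler_wpM2l //.
rewrite ler_wpM2l ?invr_ge0 ?exprn_ge0 ?(ltW q_gt0) //.
(* At most |F|^m vectors u are nonzero. *)
by rewrite -(cardV m) ler_nat max_card.
Qed.

(** Pairwise error bound for maximum-likelihood guessing: if a_i is maximal then a_j <= sqrt (a_i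
    a_j), so row i of the double sum alone dominates all the other a_j. *)
Lemma max_ge_sum (I : finType) (i0 : I) (a : I -> R) :
  (forall i, 0 <= a i) ->
  exists i, \sum_j a j - \sum_j \sum_(k | k != j) Num.sqrt (a j * a k) <= a i.
Proof.
move=> a_ge0; have [i _ imax] := arg_maxP a (erefl : xpredT i0).
exists i; rewrite lerBlDr (bigD1 i) //= lerD2l [leRHS](bigD1 i) //= ler_wpDr //.
  by apply: sumr_ge0 => j _; apply: sumr_ge0 => k _; exact: sqrtr_ge0.
apply: ler_sum => j _; rewrite -[leLHS]sqr_sqrtr // expr2 sqrtrM //.
by apply: ler_wpM2r; rewrite ?sqrtr_ge0 // ler_wsqrtr //; exact: imax.
Qed.

Lemma sqrtr_prod (I : finType) (a : I -> R) :
  (forall i, 0 <= a i) -> Num.sqrt (\prod_i a i) = \prod_i Num.sqrt (a i).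
Proof.
move=> a_ge0; suff [] : 0 <= \prod_i a i /\
  Num.sqrt (\prod_i a i) = \prod_i Num.sqrt (a i) by [].
elim/big_rec2: _ => [|i x y _ [x_ge0 xy]]; first by rewrite sqrtr1 ler01.
by rewrite mulr_ge0 // sqrtrM // xy.
Qed.


(* The bound is the Bhattacharyya bound on the error of decoding the source q
   from its coset modulo the row space of a random generator matrix G; D z is
   the most likely element of the coset of z. *)
Lemma exists_decoder (F : finFieldType) (q : F -> R) m n :
  (forall a, 0 <= q a) -> \sum_a q a = 1 ->
  exists (G : 'M[F]_(m, n)) (D : 'rV[F]_n -> 'rV[F]_n),
    let S := (\sum_z \prod_k q (D z 0 k)) / #|F|%:R ^+ m in
    [/\ forall z, exists u, D z = z + u *m G,
        1 - #|F|%:R ^+ m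
            * ((\sum_w \sum_a Num.sqrt (q a * q (a + w))) / #|F|%:R) ^+ n <= S
      & S <= 1].
Proof.
move=> q_ge0 q1; pose B w := \sum_a Num.sqrt (q a * q (a + w)).
have B_ge0 w : 0 <= B w by apply: sumr_ge0 => a _; exact: sqrtr_ge0.
have cardV k : (#|{: 'rV[F]_k}|%:R : R) = #|F|%:R ^+ k by rewrite card_mx mul1n natrX.
have F_gt0 : 0 < #|F|%:R :> R by rewrite ltr0n; apply/card_gt0P; exists 0.
pose Q (z : 'rV[F]_n) := \prod_k q (z 0 k).
have Q_ge0 z : 0 <= Q z by apply: prodr_ge0 => k _.
have Q1 : \sum_z Q z = 1.
  by rewrite (bigA_distr_rV (fun=> q)) big1 // => k _.
(* The Bhattacharyya coefficient of the product law and its translate by w factors over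
   positions. *)
have QQ w : \sum_z Num.sqrt (Q z * Q (z + w)) = \prod_k B (w 0 k).
  rewrite -(bigA_distr_rV (fun k a => Num.sqrt (q a * q (a + w 0 k)))).
  apply: eq_bigr => z _; rewrite -big_split sqrtr_prod => [|k].
    by apply: eq_bigr => k _; rewrite mxE.
  by rewrite mulr_ge0.
have [G GE] := @exists_code F m n (fun v => \prod_k B (v 0 k))
  (fun v => prodr_ge0 _ (fun k _ => B_ge0 _)).
exists G.
(* Each coset has an element whose probability is at least the coset mass minus the pairwise
   overlaps. *)
have Dex z : exists u : 'rV[F]_m, \sum_v Q (z + v *m G) -
    \sum_v \sum_(w | w != v) Num.sqrt (Q (z + v *m G) * Q (z + w *m G))
    <= Q (z + u *m G) by exact: (max_ge_sum 0).
have [d dE] := choice Dex.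
exists (fun z => z + d z *m G); split=> [z||]; first by exists (d z).
(* Each word arises as z + v G exactly once for every v, so the masses add up to |F|^m, the
   normalisation of S; every v contributes overlaps of at most [E]. *)
- rewrite ler_pdivlMr ?exprn_gt0 // mulrBl mul1r.
  apply: le_trans (ler_sum _ (fun z _ => dE z)).
  rewrite big_split /= sumrN; apply: lerB.
    rewrite exchange_big /= -(cardV m) -sum1_card natr_sum; apply: ler_sum => v _.
    by rewrite -Q1 [leLHS](reindex_inj (addIr (v *m G))).
  set E := (X in _ <= X * _).
  have GE' : \sum_(u : 'rV[F]_m | u != 0) \prod_k B ((u *m G) 0 k) <= E.
    apply: le_trans GE _; rewrite (bigA_distr_rV (fun=> B)) prodr_const card_ord.
    by rewrite /E expr_div_n mulrAC -mulrA.
  (* Writing w = v + u, the overlaps at fixed v become Bhattacharyya coefficients for the translates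
     u G with u != 0. *)
  have Ev (v : 'rV[F]_m) : \sum_z \sum_(w | w != v)
      Num.sqrt (Q (z + v *m G) * Q (z + w *m G)) <= E.
    rewrite exchange_big /= (reindex_inj (addrI v)) /=.
    rewrite (eq_bigl (fun u => u != 0)) => [|u]; last first.
      by rewrite -[X in _ == X]addr0 (inj_eq (addrI v)).
    apply: le_trans GE'; apply: ler_sum => u _; rewrite -QQ.
    rewrite [leRHS](reindex_inj (addIr (v *m G))) /=.
    by under eq_bigr => z _ do rewrite mulmxDl addrA.
  rewrite exchange_big /= -(cardV m) -sum1_card natr_sum mulr_sumr.
  by apply: ler_sum => v _; rewrite mulr1 Ev.
(* The guess is one summand of its coset sum, and the coset sums over all z total |F|^m. *)
- rewrite ler_pdivrMr ?exprn_gt0 // mul1r -(cardV m) -sum1_card natr_sum.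
  apply: (@le_trans _ _ (\sum_z \sum_v Q (z + v *m G))).
    apply: ler_sum => z _; rewrite (bigD1 (d z)) //= lerDl.
    by apply: sumr_ge0.
  rewrite exchange_big /=; apply: ler_sum => v _.
  by rewrite -Q1 [leRHS](reindex_inj (addIr (v *m G))).
Qed.
End Codes.

(** * Incoherent decoding *)

Section Decoding.

Variable R : realType.
Local Notation C := (R[i]).

(** The nontrivial additive character of F_2. *)
Definition sgn (a : 'F_2) : C := if a == 0 then 1 else -1.

Lemma F2P (P : 'F_2 -> Prop) : P 0 -> P 1 -> forall a, P a.
Proof.
move=> P0 P1 [[|[|//]] lt_a2].
  by rewrite (_ : Ordinal _ = 0) //; apply: val_inj.
by rewrite (_ : Ordinal _ = 1) //; apply: val_inj.
Qed.

Lemma sgn0 : sgn 0 = 1. Proof. by rewrite /sgn eqxx. Qed.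
Lemma sgn1 : sgn 1 = -1. Proof. by []. Qed.

Lemma sgnD a b : sgn (a + b) = sgn a * sgn b.
Proof.
elim/F2P: a; elim/F2P: b; rewrite ?addr0 ?add0r ?sgn0 ?mulr1 ?mul1r //.
by rewrite sgn1 mulN1r opprK.
Qed.

Lemma sgnN a : sgn (- a) = sgn a.
Proof. by elim/F2P: a. Qed.

Lemma conj_sgn a : (sgn a)^* = sgn a.
Proof. by rewrite /sgn; case: ifP; rewrite ?rmorphN rmorph1. Qed.

(** Up to normalisation, entry x of the conjugate-basis vector labelled z. *)
Definition character n (z x : 'rV['F_2]_n) : C := sgn ((z *m x^T) 0 0).

Lemma characterE n (z x : 'rV['F_2]_n) :
  character z x = \prod_k sgn (z 0 k * x 0 k).
Proof.
rewrite /character mxE (big_morph sgn sgnD sgn0).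
by apply: eq_bigr => k _; rewrite mxE.
Qed.

Lemma characterDl n (z w x : 'rV['F_2]_n) :
  character (z + w) x = character z x * character w x.
Proof. by rewrite /character mulmxDl mxE sgnD. Qed.

Lemma characterBr n (z x y : 'rV['F_2]_n) :
  character z (x - y) = character z x * character z y.
Proof. by rewrite /character linearB mulmxBr !mxE sgnD sgnN. Qed.

Lemma conj_character n (z x : 'rV['F_2]_n) : (character z x)^* = character z x.
Proof. exact: conj_sgn. Qed.

(** Orthogonality of characters: for x != 0, translating z by a vector on which the character is -1
    negates the sum. *)
Lemma sum_character n (x : 'rV['F_2]_n) :
  \sum_z character z x = (x == 0)%:R * 2 ^+ n.
Proof.
have [->|x0] := eqVneq x 0.
  rewrite mul1r (eq_bigr (fun=> 1)) => [|z _]; last first.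
    by rewrite /character trmx0 mulmx0 mxE sgn0.
  by rewrite sumr_const card_mx card_Fp // mul1n natrX.
have /row_freeP[c xc] : row_free x by rewrite /row_free rank_rV x0.
have c1 : character c^T x = -1.
  by rewrite /character -trmx_mul xc !mxE sgn1.
rewrite mul0r; set S := \sum_z _.
have SN : S = - S.
  rewrite {1}/S (reindex_inj (addrI c^T)) -sumrN /=.
  by apply: eq_bigr => z _; rewrite characterDl c1 mulN1r.
have : S *+ 2 == 0 by rewrite mulr2n {1}SN addNr.
by rewrite mulrn_eq0 => /eqP.
Qed.

Lemma quad_formE n (u : 'rV[C]_n) (X : 'M[C]_n) :
  (u *m X *m mxadj u) 0 0 = \sum_x \sum_y u 0 x * X x y * (u 0 y)^*.
Proof.
rewrite mxE exchange_big; apply: eq_bigr => y _.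
by rewrite !mxE mulr_suml.
Qed.

(** Summing all entries evaluates the quadratic form at the all-ones vector, so only the column sums
    of K enter. The overlap with a power of Phi_2 is such a sum. *)
Lemma sum_conjugation m n (K : 'M[C]_(m, n)) (X : 'M[C]_n) :
  \sum_i \sum_j (K *m X *m mxadj K) i j
  = \sum_x \sum_y (\sum_i K i x) * X x y * (\sum_j K j y)^*.
Proof.
pose e : 'rV[C]_m := const_mx 1.
have eK x : (e *m K) 0 x = \sum_i K i x.
  by rewrite mxE; apply: eq_bigr => i _; rewrite mxE mul1r.
transitivity (((e *m K) *m X *m mxadj (e *m K)) 0 0); last first.
  by rewrite quad_formE; under eq_bigr => x _ do under eq_bigr => y _ do rewrite !eK.
rewrite mxadj_mul !mulmxA -!(mulmxA e) (mulmxA e) quad_formE.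
apply: eq_bigr => i _; apply: eq_bigr => j _.
by rewrite /e !mxE mul1r conjC1 mulr1.
Qed.

(* Measure the coset of z in the conjugate basis, keeping the syndrome of the
   incoherent index, and undo the phase of the estimate D z. *)
Lemma incoherent_op_decode m n (G : 'M['F_2]_(m, n))
    (D : 'rV['F_2]_n -> 'rV['F_2]_n) (t : 'F_2 -> C) (A : 'M[C]_2) :
  (forall z, exists u, D z = z + u *m G) ->
  (forall i j, A i j = t ((i : 'F_2) - (j : 'F_2))) ->
  exists2 T : 'M[C]_(2 ^ n) -> 'M[C]_(2 ^ m), incoherent_op T &
    \sum_i \sum_j T (ntensmx A n) i j
    = \sum_z \prod_k \sum_a sgn (D z 0 k * a) * t a.
Proof.
move=> DE AE.
have [g gbij gE] := ntensmx_bij 2 n; have [h [h' hK h'K] _] := ntensmx_bij 2 m.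
have conjM (x y : C) : (x * y)^* = x^* * y^* by exact: rmorphM.
pose s : C := sqrtC ((2 ^+ n)^-1).
have ss : s^* * s = (2 ^+ n)^-1.
  by rewrite geC0_conj ?sqrtC_ge0 ?invr_ge0 ?exprn_ge0 // -expr2 sqrtCK.
(* [K z] sends each basis state x to its syndrome x G^T with a phase, hence at most one nonzero
   entry per column. *)
pose syn (v : 'rV['F_2]_n) : 'I_(2 ^ m) := h' (v *m G^T).
pose K z : 'M[C]_(2 ^ m, 2 ^ n) :=
  \matrix_(i, x) ((i == syn (g x))%:R * (s * character (D z) (g x))).
exists (fun X => \sum_(K <- [seq K z | z <- index_enum _]) K *m X *m mxadj K).
  exists [seq K z | z <- index_enum _]; split=> // [M|].
    move=> /mapP[z _ ->] x; exists (syn (g x)) => i /negPf ix.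
    by rewrite mxE ix mul0r.
  rewrite big_map; apply/matrixP => x y; rewrite summxE.
  have Kxy z : (mxadj (K z) *m K z) x y =
      (g x *m G^T == g y *m G^T)%:R * (2 ^+ n)^-1 * character (D z) (g x - g y).
    rewrite mxE (bigD1 (syn (g x))) //= big1 ?addr0 => [|i /negPf ix]; last first.
      by rewrite !mxE ix mul0r conjC0 mul0r.
    rewrite !mxE eqxx mul1r (can_eq h'K) characterBr conjM conj_character -ss.
    ring.
  under eq_bigr => z _ do rewrite Kxy.
  have [Gxy|Gxy] := eqVneq; last first.
    rewrite big1 => [|z _]; last by rewrite !mul0r.
    rewrite mxE; have [xy|//] := eqVneq x y.
    by rewrite xy eqxx in Gxy.
  (* Equal syndromes make g x - g y orthogonal to the rows of G, so D z may be replaced by z, and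
     the sum over z becomes a full character sum. *)
  have chD z : character (D z) (g x - g y) = character z (g x - g y).
    have [u ->] := DE z; rewrite characterDl [X in _ * X]/character.
    rewrite -mulmxA (_ : G *m _ = 0) ?mulmx0 ?mxE ?sgn0 ?mulr1 //.
    by rewrite -[LHS]trmxK trmx_mul trmxK mulmxBl Gxy subrr trmx0.
  under eq_bigr => z _ do rewrite chD.
  rewrite mul1r -mulr_sumr sum_character subr_eq0 (bij_eq gbij) mulrCA mulVf.
    by rewrite mulr1 mxE.
  by rewrite expf_neq0 // pnatr_eq0.
(* Column sums forget the syndrome: what remains is the diagonal entry of the input at D z in the
   conjugate basis. *)
have rowK z y : \sum_i K z i y = s * character (D z) (g y).
  rewrite (bigD1 (syn (g y))) //= big1 ?addr0 => [|i /negPf iy].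
    by rewrite mxE eqxx mul1r.
  by rewrite mxE iy mul0r.
have sumE z (X : 'M[C]_(2 ^ n)) : \sum_i \sum_j (K z *m X *m mxadj (K z)) i j =
    \sum_x \sum_y (2 ^+ n)^-1 * (character (D z) (g x - g y) * X x y).
  transitivity (\sum_x \sum_y (\sum_i K z i x) * X x y * (\sum_j K z j y)^*).
    exact: sum_conjugation.
  apply: eq_bigr => x _; apply: eq_bigr => y _.
  rewrite !rowK conjM conj_character characterBr -ss; ring.
transitivity (\sum_z \sum_i \sum_j (K z *m ntensmx A n *m mxadj (K z)) i j).
  rewrite [RHS]exchange_big; apply: eq_bigr => i _; rewrite [RHS]exchange_big /=.
  by apply: eq_bigr => j _; rewrite big_map summxE.
apply: eq_bigr => z _; rewrite sumE.
pose f v := character (D z) v * \prod_k t (v 0 k).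
(* The summand depends only on g x - g y, so one sum contributes 2^n, cancelling the normalisation;
   the other is a Fourier transform that factors over positions. *)
transitivity (\sum_x \sum_y (2 ^+ n)^-1 * f (g x - g y)).
  apply: eq_bigr => x _; apply: eq_bigr => y _; rewrite /f gE.
  by congr (_ * (_ * _)); apply: eq_bigr => k _; rewrite AE !mxE.
rewrite -(bigA_distr_rV (fun k a => sgn (D z 0 k * a) * t a)).
transitivity (\sum_(x : 'rV['F_2]_n) (2 ^+ n)^-1 * \sum_y f y).
  rewrite [RHS](reindex g (onW_bij _ gbij)); apply: eq_bigr => x _.
  rewrite mulr_sumr [RHS](reindex_inj (addrI (g x))) /=.
  rewrite [RHS](reindex_inj oppr_inj) /=.
  by rewrite [RHS](reindex g (onW_bij _ gbij)).
rewrite sumr_const card_mx card_Fp // mul1n -[LHS]mulr_natl natrX mulrA mulfV.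
  rewrite mul1r; apply: eq_bigr => y _; rewrite /f characterE.
  by rewrite -big_split.
by rewrite expf_neq0 // pnatr_eq0.
Qed.

End Decoding.

(** * Achievable rates for distillation and for cost *)

Section Rates.

Variable R : realType.
Local Notation C := (R[i]).
Local Notation "x %:C" := (real_complex R x) : ring_scope.

Lemma sum_F2 (V : nmodType) (f : 'F_2 -> V) : \sum_a f a = f 0 + f 1.
Proof.
rewrite (big_ord_recl 1) big_ord1; congr (f _ + f _); exact: val_inj.
Qed.

(** The m-th power of Phi_2 projects onto the constant vector with entries 2^(-m/2), so the overlap
    is a normalised sum of entries. *)
Lemma fidelity_Phi2 m (sigma : 'M[C]_(2 ^ m)) : psdmx sigma ->
  fidelity sigma (ntensmx (Phi2 R) m)
  = sqrtC ((\sum_i \sum_j sigma i j) / 2 ^+ m).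
Proof.
move=> psigma; pose s : C := sqrtC ((2 ^+ m)^-1).
have s_real : s^* = s by rewrite geC0_conj ?sqrtC_ge0 ?invr_ge0 ?exprn_ge0.
have ss : s * s = (2 ^+ m)^-1 by rewrite -expr2 sqrtCK.
pose phi : 'cV[C]_(2 ^ m) := const_mx s.
have -> : ntensmx (Phi2 R) m = phi *m mxadj phi.
  have [g _ gE] := ntensmx_bij 2 m; apply/matrixP => i j; rewrite gE.
  rewrite (eq_bigr (fun=> 2^-1)) => [|k _]; last by rewrite mxE.
  by rewrite prodr_const card_ord mxE big_ord1 !mxE s_real ss exprVn.
rewrite fidelity_pure // -{2}[phi]mxadjK quad_formE; congr sqrtC.
rewrite mulr_suml; apply: eq_bigr => i _; rewrite mulr_suml; apply: eq_bigr => j _.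
by rewrite !mxE !s_real mulrAC ss mulrC.
Qed.

(** 1 - s factors as |sqrt s - 1| (sqrt s + 1), and the second factor is at least 1. *)
Lemma ler_norm_sqrtC_sub1 (s : C) : 0 <= s -> s <= 1 -> `|sqrtC s - 1| <= 1 - s.
Proof.
move=> s0 s1; have x0 : 0 <= sqrtC s by rewrite sqrtC_ge0.
have -> : 1 - s = `|sqrtC s - 1| * (sqrtC s + 1).
  rewrite -[sqrtC s + 1]ger0_norm ?addr_ge0 // -normrM.
  have -> : (sqrtC s - 1) * (sqrtC s + 1) = s - 1.
    by rewrite -[X in _ = X - 1]sqrtCK; ring.
  by rewrite distrC ger0_norm // subr_ge0.
by rewrite ler_peMr // lerDr.
Qed.

Lemma expr_small (b e : R) : 0 <= b -> b < 1 -> 0 < e ->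
  exists N : nat, forall n, (N <= n)%N -> b ^+ n < e.
Proof.
move=> b0 b1 e0.
(* Bernoulli-type inequality, giving the decay b^n <= 1 / (1 + n (1 - b)). *)
have bern n : b ^+ n * (1 + n%:R * (1 - b)) <= 1.
  elim: n => [|n IH]; first by rewrite mul0r addr0 mulr1.
  apply: le_trans IH; rewrite exprSr -mulrA ler_wpM2l ?exprn_ge0 // -natr1.
  have : 0 <= n%:R * (1 - b) ^+ 2 by rewrite mulr_ge0 // sqr_ge0.
  have : 0 <= (1 - b) ^+ 2 by rewrite sqr_ge0.
  by move=> h1 h2; nra.
exists (Num.bound (e * (1 - b))^-1) => n Nn.
have eb : 0 < e * (1 - b) by rewrite mulr_gt0 // subr_gt0.
have : (e * (1 - b))^-1 < n%:R.
  apply: lt_le_trans (archi_boundP _) _; first by rewrite invr_ge0 ltW.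
  by rewrite ler_nat.
rewrite -(ltr_pM2l eb) divff ?gt_eqF // => en.
have bn0 : 0 <= b ^+ n by rewrite exprn_ge0.
rewrite ltNge; apply/negP => ebn; have := bern n.
have : e * (n%:R * (1 - b)) <= b ^+ n * (n%:R * (1 - b)).
  by rewrite ler_wpM2r // mulr_ge0 // subr_ge0 ltW.
by move=> h1 h2; nra.
Qed.

(** The squared fidelity is the quantity S of the decoder, which lies between 1 minus the stated
    bound and 1. *)
Lemma distill_twirled (t : R) m n : 0 <= t -> t <= 2^-1 ->
  exists2 T : 'M[C]_(2 ^ n) -> 'M[C]_(2 ^ m), incoherent_op T &
    psdmx (twirled_qubit t%:C) ->
    `|fidelity (T (ntensmx (twirled_qubit t%:C) n)) (ntensmx (Phi2 R) m) - 1|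
    <= (2 ^+ m * (2^-1 + Num.sqrt (4^-1 - t ^+ 2)) ^+ n)%:C.
Proof.
move=> t0 th.
pose q (a : 'F_2) : R := if a == 0 then 2^-1 + t else 2^-1 - t.
have q_ge0 a : 0 <= q a by rewrite /q; case: ifP => _; lra.
have q1 : \sum_a q a = 1 by rewrite sum_F2 /q /=; lra.
have [G [D []]] := exists_decoder m n q_ge0 q1.
move=> DE; rewrite card_Fp // => S_ge S_le.
pose S : R := (\sum_z \prod_k q (D z 0 k)) / 2 ^+ m.
(* The Bhattacharyya sum is (1 + 2 sqrt (q_0 q_1)) / 2, with q_0 q_1 = 1/4 - t^2. *)
have beta : (\sum_w \sum_a Num.sqrt (q a * q (a + w))) / 2%:R =
    2^-1 + Num.sqrt (4^-1 - t ^+ 2).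
  rewrite !sum_F2 !addr0 add0r.
  have -> : (1 + 1 : 'F_2) = 0 by apply: val_inj.
  rewrite /q /= -!expr2 !sqrtr_sqr !ger0_norm; [|lra|lra].
  rewrite [X in _ + (_ + Num.sqrt X)]mulrC.
  have -> : (2^-1 + t) * (2^-1 - t) = 4^-1 - t ^+ 2 by field.
  set x := Num.sqrt _; lra.
have {}S_ge : 1 - 2 ^+ m * (2^-1 + Num.sqrt (4^-1 - t ^+ 2)) ^+ n <= S.
  by rewrite -beta.
pose tC (a : 'F_2) : C := if a == 0 then 2^-1 else t%:C.
have [i j|T iT TE] := incoherent_op_decode DE (t := tC) (A := twirled_qubit t%:C).
  by rewrite mxE /tC subr_eq0.
exists T => // ptau.
rewrite fidelity_Phi2; last by apply: psdmx_incoherent_op iT (psdmx_ntens _ ptau).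
(* The Fourier transform of (1/2, t) is (1/2 + t, 1/2 - t), so each factor is [q] at a letter of D
   z. *)
have -> : (\sum_i \sum_j T (ntensmx (twirled_qubit t%:C) n) i j) / 2 ^+ m = S%:C.
  rewrite TE /S fmorph_div rmorphXn /= rmorph_nat; congr (_ / _).
  rewrite rmorph_sum; apply: eq_bigr => z _; rewrite rmorph_prod.
  apply: eq_bigr => k _; rewrite sum_F2 mulr0 mulr1 /tC /q.
  elim/F2P: (D z 0 k); rewrite ?sgn0 ?sgn1 /= ?rmorphB ?rmorphD fmorphV rmorph_nat.
    by rewrite !mul1r.
  by rewrite mul1r mulN1r.
have S0 : 0 <= S.
  rewrite divr_ge0 ?exprn_ge0 // sumr_ge0 // => z _; exact: prodr_ge0.
apply: le_trans (ler_norm_sqrtC_sub1 _ _) _; rewrite ?lecR //.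
rewrite -(rmorph1 (real_complex R)) -rmorphB lecR; lra.
Qed.

Lemma floorn_div (n k : nat) : (0 < k)%N ->
  (floorn (n%:R * k%:R^-1 : R) * k <= n)%N.
Proof.
move=> k0; rewrite /floorn.
have x_ge0 : 0 <= n%:R * k%:R^-1 :> R by rewrite mulr_ge0 ?invr_ge0 ?ler0n.
have fl_ge0 : 0 <= Num.floor (n%:R * k%:R^-1 : R) by rewrite floor_ge0.
rewrite -(ler_nat R) natrM -ler_pdivlMr ?ltr0n // natr_absz ger0_norm //.
exact: floor_le.
Qed.

Lemma distill_achievable_pos d (rho : 'M[C]_d) a b :
  density rho -> a != b -> rho a b != 0 ->
  exists2 r : R, 0 < r & distill_achievable rho r.
Proof.
move=> drho ab rab.
have [T0 iT0 T0E] := incoherent_op_twirl drho ab.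
have [t tE] : exists t : R, `|rho a b| = t%:C 
  by exists (complex.Re `|rho a b|); rewrite RRe_real // normr_real.
have t_gt0 : 0 < t by rewrite -ltcR -tE normr_gt0.
rewrite tE in T0E.
have ptau : psdmx (twirled_qubit t%:C).
  by rewrite -T0E; apply: psdmx_incoherent_op iT0 drho.1.
(* Positivity at the vector (1, -1) gives 1 - 2t >= 0. *)
have t_le : t <= 2^-1.
  have := ptau.2 (\row_i (if i == 0 then 1 else -1)).
  rewrite quad_formE; set v := (X in 0 <= X).
  have -> : v = (1 - t *+ 2)%:C.
    rewrite /v !big_ord_recl !big_ord0 !mxE /= ?rmorphN !conjC1.
    by rewrite rmorphB rmorph1 rmorphMn; field.
  by rewrite -(rmorph0 (real_complex R)) lecR; lra.
(* beta^n splits into two factors c^n: one absorbs 2^m, the other tends to 0. *)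
pose beta := 2^-1 + Num.sqrt (4^-1 - t ^+ 2); pose c := Num.sqrt beta.
have beta_ge0 : 0 <= beta by rewrite addr_ge0 ?sqrtr_ge0 // invr_ge0.
have beta_lt1 : beta < 1.
  have : Num.sqrt (4^-1 - t ^+ 2) < Num.sqrt (2^-1 ^+ 2).
    by rewrite ltr_sqrt; [nra | lra].
  rewrite sqrtr_sqr ger0_norm ?invr_ge0 // /beta; lra.
have c_ge0 : 0 <= c := sqrtr_ge0 _.
have cc : beta = c * c by rewrite -expr2 sqr_sqrtr.
have c_lt1 : c < 1 by rewrite -[1]sqrtr1 ltr_sqrt.
have [k ck] : exists k : nat, forall n, (k <= n)%N -> c ^+ n < 2^-1.
  by apply: expr_small => //; rewrite invr_gt0.
(* The exponent k + 1 is positive, so its inverse is a positive rate; at that rate m (k + 1) <= n,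
   hence 2^m c^n <= 1. *)
have {}ck : c ^+ k.+1 <= 2^-1 by rewrite ltW // ck.
exists k.+1%:R^-1; first by rewrite invr_gt0 ltr0n.
pose m n := floorn (n%:R * k.+1%:R^-1 : R).
have bound n : 2 ^+ m n * beta ^+ n <= c ^+ n.
  rewrite cc exprMn mulrA ler_piMl ?exprn_ge0 //.
  have mk : (m n * k.+1 <= n)%N by exact: floorn_div.
  apply: (@le_trans _ _ (2 ^+ m n * (c ^+ k.+1) ^+ m n)).
    rewrite ler_wpM2l ?exprn_ge0 // -exprM mulnC.
    by apply: ler_wiXn2l => //; exact: ltW.
  rewrite -exprMn exprn_ile1 ?mulr_ge0 ?exprn_ge0 //.
  by rewrite -ler_pdivlMl // mulr1.
have Tex n : exists T : 'M[C]_(d ^ n) -> 'M[C]_(2 ^ m n), incoherent_op T /\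
    `|fidelity (T (ntensmx rho n)) (ntensmx (Phi2 R) (m n)) - 1| <= (c ^+ n)%:C.
  have [U iU UE] := incoherent_op_ntens n iT0.
  have [T iT TE] := distill_twirled (m n) n (ltW t_gt0) t_le.
  exists (T \o U); split; first exact: incoherent_op_comp.
  by rewrite /= UE T0E (le_trans (TE ptau)) // lecR.
pose T n := projT1 (cid (Tex n)).
have TP n := projT2 (cid (Tex n)).
exists T; split=> [n|e e0]; first by have [] := TP n.
have [N cN] := expr_small c_ge0 c_lt1 e0.
exists N => n /cN cn; apply: le_lt_trans (TP n).2 _.
by rewrite ltcR.
Qed.

(** For every n the target is diagonal and can be prepared exactly, so the fidelity equals 1 and not
    only in the limit. *)
Lemma cost_achievable_diag d (rho : 'M[C]_d) :
  density rho -> is_diag_mx rho -> cost_achievable rho 0.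
Proof.
move=> [prho tr1] drho.
have [pn trn] : (forall n, psdmx (ntensmx rho n)) /\ (forall n, \tr (ntensmx rho n) = 1).
  by split=> n; [exact: psdmx_ntens | rewrite mxtrace_ntens tr1 expr1n].
have diag_n n : is_diag_mx (ntensmx rho n).
  have [g gbij gE] := ntensmx_bij d n; apply/is_diag_mxP => i j ij.
  have gij : g i != g j by rewrite (bij_eq gbij); exact: ij.
  (* Distinct words differ at some letter, where the factor of the entry is an off-diagonal entry of
     [rho]. *)
  have [k gk] : exists k, g i 0 k != g j 0 k.
    apply/existsP; apply: contraNT gij => /existsPn gij.
    by apply/eqP/rowP => k; apply/eqP; have := gij k; rewrite negbK.
  by rewrite gE (bigD1 k) //= (is_diag_mxP drho) ?mul0r.
have tr_Phi2 m : \tr (ntensmx (Phi2 R) m) = 1.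
  rewrite mxtrace_ntens /mxtrace big_ord_recl big_ord1 !mxE.
  by rewrite (_ : _ + _ = 1) ?expr1n //; field.
have Tex n : exists T : 'M[C]_(2 ^ ceiln (n%:R * 0 : R)) -> 'M[C]_(d ^ n),
    incoherent_op T /\ forall X, \tr X = 1 -> T X = ntensmx rho n.
  have [T iT TE] := incoherent_op_prepare (2 ^ ceiln (n%:R * 0 : R))
    (conj (pn n) (trn n)) (diag_n n).
  by exists T.
pose T n := projT1 (cid (Tex n)).
have TP n : _ /\ forall X, \tr X = 1 -> T n X = _ := projT2 (cid (Tex n)).
exists T; split=> [n|e e0]; first by have [] := TP n.
exists 0%N => n _; rewrite (TP n).2 // fidelity_refl // trn subrr normr0.
by rewrite -(rmorph0 (real_complex R)) ltcR.
Qed.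

End Rates.

Theorem theorem7 (R : realType) (d : nat) (rho : 'M[R[i]]_d) :
  density rho ->
  distillable_coherence rho = 0%E ->
  coherence_cost rho = 0%E.
Proof.
move=> drho Cd0.
have [rho_diag|] := boolP (is_diag_mx rho).
  apply/eqP; rewrite eq_le; apply/andP; split.
    apply: ereal_inf_lbound; exists 0 => //; split => //.
    exact: cost_achievable_diag.
  by apply: le_ereal_inf_tmp => _ [r [r0 _] <-]; rewrite lee_fin.
move=> /is_diag_mxP rho_offdiag; exfalso; apply: rho_offdiag => a b ab.
apply/eqP; apply: contraT => rab.
have [r r0 dr] := distill_achievable_pos drho ab rab.
have : (r%:E <= distillable_coherence rho)%E.
  by apply: ereal_sup_ubound; exists r => //; split=> //; exact: ltW.
by rewrite Cd0 lee_fin leNgt r0.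
Qed.
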